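(* For every partition $\mu=(\mu_1,\ldots,\mu_\ell)$, \[ h_\mu=\sum_T \tilde s_{\overline{shape(T)}}, \] where the sum is over all tableaux $T$ (in French notation) of skew shape $\lambda/(\lambda_2)$ for some partition $\lambda$ (i.e. the leftmost $\lambda_2$ cells of the first row are left blank and all other cells of the diagram of $\lambda$ are filled), whose filled cells contain non-empty multisets of positive integers, which are column strict with respect to the total order on multisets described below (weakly increasing from left to right along rows and strictly increasing from bottom to top up columns, among filled cells), and whose total content (multiset union of all entries) is $\{\!\!\{1^{\mu_1},2^{\mu_2},\ldots,\ell^{\mu_\ell}\}\!\!\}$. Here for $\lambda=(\lambda_1,\lambda_2,\ldots)$ with outer shape $shape(T)=\lambda$, $\overline{\lambda}=(\lambda_2,\lambda_3,\ldots)$.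
   Context: Multisets are totally ordered lexicographically as words, after listing the entries of each multiset in increasing order. $Sym=\mathbb{Q}[p_1,p_2,\ldots]$ with standard bases $h_\lambda,s_\lambda$. A multiset partition of a multiset $S$ is a multiset of nonempty multisets with multiset union $S$; $\tilde m(\pi)$ is the partition of multiplicities of the distinct multisets in $\pi$. The basis $\{\tilde h_\lambda\}$ is determined recursively by $h_\lambda=\sum_{\pi}\tilde h_{\tilde m(\pi)}$, the sum over all multiset partitions $\pi$ of $\{\!\!\{1^{\lambda_1},\ldots,\ell(\lambda)^{\lambda_{\ell(\lambda)}}\}\!\!\}$. The irreducible character basis is $\tilde s_\lambda=\sum_{|\mu|\le|\lambda|}K^{-1}_{(n-|\lambda|,\lambda),(n-|\mu|,\mu)}\tilde h_\mu$ for any $n\ge2|\lambda|$ (independent of such $n$), with $K^{-1}$ the inverse Kostka matrix ($s_\alpha=\sum_\beta K^{-1}_{\alpha\beta}h_\beta$). *)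

(* Defs.v *)
From HB Require Import structures.
From mathcomp Require Import all_boot all_order all_algebra.
From mathcomp Require Import mpoly.
Set Implicit Arguments. Unset Strict Implicit. Unset Printing Implicit Defensive.
Import Order.TTheory GRing.Theory Num.Theory.

Fixpoint words {T : Type} (xs : seq T) (k : nat) : seq (seq T) :=
  match k with
  | 0 => [:: [::]]
  | k'.+1 => [seq x :: w | x <- xs, w <- words xs k']
  end.

Definition words_le {T : Type} (xs : seq T) (k : nat) : seq (seq T) :=
  flatten [seq words xs i | i <- iota 0 k.+1].

Fixpoint prodseqs {T : Type} (ls : seq (seq T)) : seq (seq T) :=
  match ls with
  | [::] => [:: [::]]
  | l :: ls' => [seq x :: w | x <- l, w <- prodseqs ls']
  end.

Definition is_partition (la : seq nat) : bool :=
  sorted geq la && all (fun k => 0 < k) la.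

Definition partitions (m : nat) : seq (seq nat) :=
  [seq p <- words_le (iota 1 m) m | is_partition p & sumn p == m].

(* A finite multiset of positive integers is represented by the list of its
   entries in increasing order.  The multiset {{1^la_1, ..., l^la_l}}: *)
Definition msetof (la : seq nat) : seq nat :=
  flatten [seq nseq (nth 0 la i) i.+1 | i <- iota 0 (size la)].

(* Total order on multisets: lexicographic order on the increasing words
   (a proper prefix is smaller). *)
Fixpoint lexle (s t : seq nat) : bool :=
  match s, t with
  | [::], _ => true
  | _ :: _, [::] => false
  | x :: s', y :: t' => (x < y) || ((x == y) && lexle s' t')
  end.
Definition lexlt (s t : seq nat) : bool := (s != t) && lexle s t.

Definition blocks (l N : nat) : seq (seq nat) :=
  [seq b <- words_le (iota 1 l) N | (b != [::]) && sorted leq b].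

(* A multiset partition of S is a multiset of nonempty multisets whose
   multiset union is S; it is represented by the list of its blocks,
   each block a multiset (increasing list), the list sorted by lexle. *)
Definition is_mset_partition (S : seq nat) (pi : seq (seq nat)) : bool :=
  all (fun b => (b != [::]) && sorted leq b) pi && sorted lexle pi
  && perm_eq (flatten pi) S.

Definition mset_partitions (S : seq nat) : seq (seq (seq nat)) :=
  [seq pi <- words_le (blocks (foldr maxn 0 S) (size S)) (size S)
     | is_mset_partition S pi].

Definition mult_partition (pi : seq (seq nat)) : seq nat :=
  sort geq [seq count_mem b pi | b <- undup pi].

(* T (list of rows, bottom row first: French or English is irrelevant
   here) is a semistandard tableau of shape la and content mu *)
Definition is_ssyt (la mu : seq nat) (T : seq (seq nat)) : bool :=
  [&& map size T == la,
      all (sorted leq) T,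
      all (fun i => all (fun j => nth 0 (nth [::] T i) j < nth 0 (nth [::] T i.+1) j)
                        (iota 0 (size (nth [::] T i.+1))))
          (iota 0 (size T).-1) &
      perm_eq (flatten T) (msetof mu)].

Definition kostka (la mu : seq nat) : nat :=
  size [seq T <- prodseqs [seq words (iota 1 (size mu)) k | k <- la]
          | is_ssyt la mu T].

Local Open Scope ring_scope.

(* Kostka matrix on the partitions of m: K_{la,mu} = kostka la mu,
   so that h_mu = \sum_la K_{la,mu} s_la. *)
Definition kostka_mx (m : nat) : 'M[rat]_(size (partitions m)) :=
  \matrix_(i, j) (kostka (nth [::] (partitions m) i)
                          (nth [::] (partitions m) j))%:R.

(* Inverse Kostka coefficient K^{-1}_{al,be} (al, be partitions of the same
   m), with the convention of the paper: s_al = \sum_be K^{-1}_{al,be} h_be.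
   From h = K^T s we get s = (K^{-1})^T h, whence the transposition. *)
Definition inv_kostka (al be : seq nat) : rat :=
  let m := sumn al in
  if (al \in partitions m) && (be \in partitions m) then
    match ltnP (index be (partitions m)) (size (partitions m)),
          ltnP (index al (partitions m)) (size (partitions m)) with
    | LtnNotGeq hb, LtnNotGeq ha =>
        invmx (kostka_mx m) (Ordinal hb) (Ordinal ha)
    | _, _ => 0
    end
  else 0.

Definition hsym (n k : nat) : {mpoly rat[n]} :=
  \sum_(m : 'X_{1..n < k.+1} | mdeg m == k) 'X_[m].

Definition hpart (n : nat) (la : seq nat) : {mpoly rat[n]} :=
  \prod_(k <- la) hsym n k.

(* \tilde h, by the recursion h_la = \sum_pi \tilde h_{\tilde m(pi)}
   over multiset partitions pi of {{1^la_1,...}}: the unique pi with |la|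
   blocks (all singletons) contributes \tilde h_la, all others have fewer
   blocks.  [htilde_f] uses fuel k >= |la|. *)
Fixpoint htilde_f (n k : nat) (la : seq nat) : {mpoly rat[n]} :=
  match k with
  | 0 => hpart n la
  | k'.+1 => hpart n la -
      \sum_(pi <- mset_partitions (msetof la) | (size pi < sumn la)%N)
         htilde_f n k' (mult_partition pi)
  end.

Definition htilde (n : nat) (la : seq nat) : {mpoly rat[n]} :=
  htilde_f n (sumn la) la.

Definition padpart (N : nat) (la : seq nat) : seq nat :=
  [seq k <- ((N - sumn la)%N) :: la | k != 0%N].

(* \tilde s_la = \sum_{|mu| <= |la|} K^{-1}_{(N-|la|,la),(N-|mu|,mu)} \tilde h_mu,
   for N >= 2|la|; we take N = 2|la|. *)
Definition stilde (n : nat) (la : seq nat) : {mpoly rat[n]} :=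
  let N := (2 * sumn la)%N in
  \sum_(m < (sumn la).+1) \sum_(mu <- partitions m)
     inv_kostka (padpart N la) (padpart N mu) *: htilde n mu.

Local Close Scope ring_scope.

(* A tableau T is given by its list of rows, bottom row first (French
   notation); row i lists the entries of its filled cells from left to
   right.  For the skew shape la/(la_2), row 1 has la_1 - la_2 filled cells
   occupying columns la_2, ..., la_1 - 1, and row i >= 2 has la_i filled
   cells in columns 0, ..., la_i - 1. *)

Definition tab_inner (T : seq (seq (seq nat))) : seq nat :=
  [:: size (nth [::] T 1)].
Definition tab_shape (T : seq (seq (seq nat))) : seq nat :=
  match T with
  | [::] => [::]
  | r0 :: rs => (size r0 + size (nth [::] T 1))%N :: map size rs
  end.

Definition tab_cell (T : seq (seq (seq nat))) (i j : nat) : option (seq nat) :=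
  let off := nth 0 (tab_inner T) i in
  if (off <= j) && (j < off + size (nth [::] T i)) then
    Some (nth [::] (nth [::] T i) (j - off))
  else None.

Definition is_skew_tableau (mu : seq nat) (T : seq (seq (seq nat))) : bool :=
  [&& is_partition (tab_shape T),
      tab_inner T == [:: nth 0 (tab_shape T) 1],
      all (all (fun b => (b != [::]) && sorted leq b && all (fun x => 0 < x) b)) T,
      all (sorted lexle) T,
      all (fun i => all (fun j =>
             match tab_cell T i j, tab_cell T i.+1 j with
             | Some a, Some b => lexlt a b
             | _, _ => true
             end) (iota 0 (nth 0 (tab_shape T) 0)))
          (iota 0 (size T)) &
      perm_eq (flatten (flatten T)) (msetof mu)].

Definition skew_tableaux (mu : seq nat) : seq (seq (seq (seq nat))) :=
  let N := sumn mu in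
  [seq T <- words_le (words_le (blocks (size mu) N) N) N.+1
     | is_skew_tableau mu T].

Definition bar (la : seq nat) : seq nat := behead la.

(* Main.v *)
(** Collecting the entries of a tableau T into a multiset partition pi, it
    suffices to show that h~_{m(pi)} is the sum of s~_{bar(shape T)} over the T
    with entries pi.  Writing empty multisets, the least letter, into the blank
    cells, these T become the semistandard tableaux of shape (N-|la|, la) whose
    content is pi together with N-|pi| empty multisets.  Kostka numbers do not
    depend on the order of the content, so there are
    K_{(N-|la|,la),(N-|nu|,nu)} of them, with nu = m(pi).  For N >= 2|nu| this
    number does not depend on N and vanishes unless |la| <= |nu|; since the Kostka
    matrix is unitriangular for the lexicographic order, the relation
    defining s~ inverts to h~_nu = sum_la K_{(N-|la|,la),(N-|nu|,nu)} s~_la.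

    Semistandard tableaux are counted as chains of interlacing partitions, where
    the symmetry in the content is a reflection of each partition in a box. *)

Require Import Defs.
From HB Require Import structures.
From mathcomp Require Import all_boot all_order all_algebra.
From mathcomp Require Import mpoly.
From mathcomp Require Import zify.
Import GRing.Theory.

Set Implicit Arguments.
Unset Strict Implicit.
Unset Printing Implicit Defensive.

(** * Chains of horizontal strips *)

(** The skew shape [la/nu] is a horizontal strip. Both lists have the same length: emptied rows stay
    as zeros, and the default of [head] bounds the last row below by zero. *)
Fixpoint interlace (la nu : seq nat) : bool :=
  match la, nu with
  | [::], [::] => true
  | a :: la', n :: nu' => (head 0 la' <= n <= a) && interlace la' nu'
  | _, _ => false
  end.

Fixpoint interlacing (la : seq nat) : seq (seq nat) :=
  match la with
  | [::] => [:: [::]]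
  | a :: la' =>
      [seq n :: nu | n <- iota (head 0 la') (a.+1 - head 0 la'),
                     nu <- interlacing la']
  end.

Definition strip_removals (la : seq nat) (b : nat) : seq (seq nat) :=
  [seq nu <- interlacing la | sumn nu + b == sumn la].

(** Kostka numbers in Gelfand-Tsetlin form: the head of [c] is the multiplicity of the largest
    letter, whose cells form the outermost strip. *)
Fixpoint strip_chains (c la : seq nat) : nat :=
  match c with
  | [::] => sumn la == 0
  | b :: c' => \sum_(nu <- strip_removals la b) strip_chains c' nu
  end.

Lemma mem_cons_allpairs (T : eqType) (s : seq T) (t : seq (seq T)) x w :
  (x :: w \in [seq y :: v | y <- s, v <- t]) = (x \in s) && (w \in t).
Proof.
apply/allpairsP/andP => [[[y v] /= [ys vt [-> ->]]]|[xs wt]] //.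
by exists (x, w).
Qed.

Lemma uniq_cons_allpairs (T : eqType) (s : seq T) (t : seq (seq T)) :
  uniq s -> uniq t -> uniq [seq y :: v | y <- s, v <- t].
Proof. by move=> us ut; apply: allpairs_uniq => // -[x v] [y w] _ _ /= [-> ->]. Qed.

Lemma mem_interlacing la nu : (nu \in interlacing la) = interlace la nu.
Proof.
elim: la nu => [|a la IH] [|n nu] //=.
  by apply/negbTE/negP => /allpairsP[[x v] [_ _]].
rewrite mem_cons_allpairs IH mem_iota; congr (_ && _); lia.
Qed.

Lemma uniq_interlacing la : uniq (interlacing la).
Proof. by elim: la => //= a la IH; apply: uniq_cons_allpairs; rewrite ?iota_uniq. Qed.

Lemma mem_strip_removals la b nu :
  (nu \in strip_removals la b) = interlace la nu && (sumn nu + b == sumn la).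
Proof. by rewrite mem_filter mem_interlacing andbC. Qed.

Lemma uniq_strip_removals la b : uniq (strip_removals la b).
Proof. exact: filter_uniq (uniq_interlacing la). Qed.

(** A horizontal strip has at most one cell per column, hence no more cells than the first row is
    long. *)
Lemma interlace_sumn_behead la nu :
  interlace la nu -> sumn la <= head 0 la + sumn nu.
Proof.
elim: la nu => [|a la IH] [|n nu] //= /andP[h /IH]; lia.
Qed.

(* The Bender-Knuth involution in Gelfand-Tsetlin form: with [la] above and
   [ka] below, row [nu] is free to move inside a box, whose i-th side is
   [max(ka_i, la_{i+1}), min(la_i, ka_{i-1})]; it is reflected in that box.
   The argument [b] stands for ka_{i-1}. *)
Fixpoint box_reflect (b : nat) (la nu ka : seq nat) : seq nat :=
  match la, nu, ka with
  | a :: la', n :: nu', k :: ka' =>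
      (maxn k (head 0 la') + minn a b - n) :: box_reflect k la' nu' ka'
  | _, _, _ => [::]
  end.

(** The boxes do not depend on [nu], so reflecting twice is the identity. For the sizes, the lower
    side of one box and the upper side of the next are the maximum and the minimum of the same two
    numbers, so they add up to [ka_i + la_{i+1}]; only the first minimum is left over. *)
Lemma box_reflect_interlace b la nu ka :
    interlace la nu -> interlace nu ka -> head 0 nu <= b ->
  [/\ interlace la (box_reflect b la nu ka),
      interlace (box_reflect b la nu ka) ka,
      head 0 (box_reflect b la nu ka) <= b,
      box_reflect b la (box_reflect b la nu ka) ka = nu &
      sumn (box_reflect b la nu ka) + sumn nu + head 0 la
        = sumn la + sumn ka + minn (head 0 la) b].
Proof.
elim: la nu ka b => [|a la IH] [|n nu] [|k ka] b //=.
  by rewrite min0n.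
move=> /andP[h1 i1] /andP[h2 i2] h3.
have [|-> i3 hb -> hs] := IH _ _ k i1 i2; first by lia.
rewrite i3.
have hnu : head 0 la <= n /\ head 0 nu <= k by lia.
split.
- lia.
- rewrite andbT; lia.
- lia.
- congr cons; lia.
- by move: hs h1; case: (la) i1 (hnu) => [|a' la'] /=; lia.
Qed.

(** Reflecting the middle row gives [|nu'| = |la| + |ka| - |nu|], so the two strip sizes are
    exchanged while both ends stay fixed. *)
Lemma strip_chains_swap a b c la :
  strip_chains (a :: b :: c) la = strip_chains (b :: a :: c) la.
Proof.
pose pairs a b := [seq (nu, ka) | nu <- strip_removals la a, ka <- strip_removals nu b].
have pairsE a' b' : strip_chains [:: a', b' & c] la =
    \sum_(p <- pairs a' b') strip_chains c p.2.
  by rewrite /pairs big_allpairs_dep /=.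
(* The first entry is bounded above by [la_1] alone, so [head 0 la] is the neutral choice of the
   bound. *)
pose f p := (box_reflect (head 0 la) la p.1 p.2, p.2 : seq nat).
have uniq_pairs a' b' : uniq (pairs a' b').
  apply: allpairs_uniq_dep => [|nu _|]; try exact: uniq_strip_removals.
  move=> [x y] [x' y'] _ _ /= [<- <-] //.
have mem_pairs a' b' nu ka : (nu, ka) \in pairs a' b' =
   [&& interlace la nu, interlace nu ka, sumn nu + a' == sumn la & sumn ka + b' == sumn nu].
  apply/allpairsPdep/idP => [[x [y [+ + [-> ->]]]]|].
    by rewrite !mem_strip_removals => /andP[-> ->] /andP[-> ->].
  case/and4P=> h1 h2 h3 h4; exists nu, ka.
  by rewrite !mem_strip_removals h1 h2 h3 h4.
have head_le nu : interlace la nu -> head 0 nu <= head 0 la.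
  by case: (la) (nu) => [|x la'] [|y nu'] //= /andP[/andP[]].
have f_pairs a' b' p : p \in pairs a' b' -> f p \in pairs b' a' /\ f (f p) = p.
  case: p => nu ka; rewrite !mem_pairs => /and4P[i1 i2 /eqP s1 /eqP s2].
  have [-> -> _ e hs] := box_reflect_interlace i1 i2 (head_le _ i1).
  split; last by rewrite /f /= e.
  rewrite /=; lia.
rewrite !pairsE.
have pe : perm_eq (pairs b a) (map f (pairs a b)).
  apply: uniq_perm => //.
    rewrite map_inj_in_uniq // => p q /f_pairs[_ e1] /f_pairs[_ e2] e.
    by rewrite -e1 e e2.
  move=> p; apply/idP/mapP => [/f_pairs[fp e]|[q /f_pairs[fq _] ->] //].
  by exists (f p).
by rewrite (perm_big _ pe) big_map.
Qed.

Lemma strip_chains_perm c c' la :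
  perm_eq c c' -> strip_chains c la = strip_chains c' la.
Proof.
elim: c c' la => [|a c IH] c' la.
  by rewrite perm_sym => /perm_nilP ->.
have front : forall s la, a \in s -> strip_chains s la = strip_chains (a :: rem a s) la.
  elim=> // b s IHs la'; rewrite  inE [rem _ _]/= eq_sym.
  have [->|nab] //= := eqVneq b a.
  move=> as_; rewrite -/(strip_chains [:: a, b & rem a s] la') strip_chains_swap /=.
  by apply: eq_bigr => nu _; rewrite IHs.
move=> p; have ac' : a \in c' by rewrite -(perm_mem p) inE eqxx.
rewrite (front _ _ ac') /=; apply: eq_bigr => nu _; apply: IH.
by rewrite -(perm_cons a) (perm_trans p) ?perm_to_rem.
Qed.

Lemma strip_chains_head_lt a la b c : a < b -> strip_chains (b :: c) (a :: la) = 0.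
Proof.
move=> ab; rewrite [LHS]/= big_seq big1 // => nu.
rewrite mem_strip_removals => /andP[/interlace_sumn_behead] /=; lia.
Qed.

Lemma interlace_rcons0 la nu :
  interlace (rcons la 0) nu =
  (nu == rcons (take (size la) nu) 0) && interlace la (take (size la) nu).
Proof.
elim: la nu => [|a la IH] [|n nu] //=; last first.
  rewrite IH eqseq_cons eqxx /=.
  have -> : head 0 (rcons la 0) = head 0 la by case: (la).
  by rewrite andbCA.
by rewrite eqseq_cons andbT leqn0; case: (nu) => [|? ?]; rewrite ?andbF ?andbT.
Qed.

(** Interlacing compares lists of equal length, so shapes that differ by an empty row have to be
    identified explicitly. *)
Lemma strip_chains_rcons0 c la : strip_chains c (rcons la 0) = strip_chains c la.
Proof.
elim: c la => [|b c IH] la /=; first by rewrite sumn_rcons addn0.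
have pe : perm_eq (strip_removals (rcons la 0) b)
    [seq rcons nu 0 | nu <- strip_removals la b].
  apply: uniq_perm; rewrite ?map_inj_uniq ?uniq_strip_removals //.
    by move=> x y /rcons_inj[].
  move=> nu; rewrite mem_strip_removals interlace_rcons0 sumn_rcons addn0.
  apply/andP/mapP => [[/andP[/eqP e i] s]|[nu' + ->]].
    exists (take (size la) nu) => //; rewrite mem_strip_removals i.
    by move: s; rewrite {1}e sumn_rcons addn0.
  rewrite mem_strip_removals => /andP[i s].
  have sz : size nu' = size la.
    by elim: (la) (nu') i {s} => [|? ? IHl] [|? ?] //= /andP[_ /IHl ->].
  by rewrite -cats1 take_cat sz ltnn subnn take0 cats0 cats1 eqxx i sumn_rcons addn0.
by rewrite (perm_big _ pe) big_map; apply: eq_bigr => nu _.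
Qed.

(* A horizontal strip as long as the first row has to remove everything but
   the shape shifted by one row. *)
Lemma strip_chains_head_eq a la c :
  sorted geq (a :: la) -> strip_chains (a :: c) (a :: la) = strip_chains c la.
Proof.
move=> srt; rewrite -[RHS]strip_chains_rcons0 [LHS]/=.
suff pe : perm_eq (strip_removals (a :: la) a) [:: rcons la 0].
  by rewrite (perm_big _ pe) big_seq1.
apply: uniq_perm; rewrite ?uniq_strip_removals // => nu.
rewrite mem_strip_removals inE; apply/andP/eqP => [[i /eqP s]|->]; last first.
  rewrite sumn_rcons addn0 /= addnC eqxx; split=> //.
  elim: la a srt => //= b la IH a /andP[ab /IH] /= ->; rewrite andbT /=; lia.
(* Each entry of [nu] is at least the next entry of [l]; equal totals turn all these inequalities
   into equalities. *)
suff gen l : forall nu, interlace l nu -> sumn nu + head 0 l = sumn l ->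
    nu = rcons (behead l) 0 \/ l = [::].
  by have [|//] := gen _ _ i s.
elim: l => [|x l IH] [|n nu'] //=; first by right.
move=> /andP[/andP[h1 h2] i'] s'.
left; have := interlace_sumn_behead i'; case: l IH i' h1 s' => [|y l] IH i' /= h1 s' h3.
  by case: nu' i' s' h3 => //= _; move=> *; congr (_ :: _); lia.
have [|->|//] := IH _ i'; first by rewrite /=; lia.
by rewrite /=; congr cons; lia.
Qed.

(** The rows after the first lose at most [head 0 la <= b] cells, so a strip of [b.+1] cells must
    take one from the first row. Hence the longer first row allows no new intermediate shape. *)
Lemma strip_chains_head_shift a la b c :
    head 0 la <= b ->
  strip_chains (b.+1 :: c) (a.+1 :: la) = strip_chains (b :: c) (a :: la).
Proof.
move=> hb /=; apply: perm_big; apply: uniq_perm; rewrite ?uniq_strip_removals //.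
case=> [|n nu]; rewrite !mem_strip_removals //=.
apply/idP/idP => /andP[/andP[h i] s].
  have := interlace_sumn_behead i; rewrite i; lia.
rewrite i; lia.
Qed.

(** * Semistandard tableaux over an ordered alphabet *)

Lemma all_flatten (T : Type) (a : pred T) (ss : seq (seq T)) :
  all a (flatten ss) = all (all a) ss.
Proof. by elim: ss => //= s ss IH; rewrite all_cat IH. Qed.

Lemma leq_sumn_mem k s : k \in s -> k <= sumn s.
Proof. by elim: s => //= a s IH; rewrite inE => /orP[/eqP ->|/IH]; lia. Qed.

Section OrderedAlphabet.

Variables (X : eqType) (le : rel X).
Hypotheses (le_refl : reflexive le) (le_trans : transitive le).
Hypothesis (le_anti : antisymmetric le).

Definition strict : rel X := fun x y => (x != y) && le x y.

Lemma strict_trans : transitive strict.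
Proof.
move=> y x z /andP[nxy xy] /andP[nyz yz]; rewrite /strict (le_trans xy yz) andbT.
by apply: contraNneq nxy => exz; apply/eqP/le_anti; rewrite xy exz yz.
Qed.

Lemma strictNle x y : strict x y -> ~~ le y x.
Proof.
move=> /andP[nxy xy]; apply: contra nxy => yx.
by apply/eqP/le_anti; rewrite xy yx.
Qed.

Fixpoint below (r r' : seq X) : bool :=
  match r, r' with
  | _, [::] => true
  | x :: s, y :: s' => strict x y && below s s'
  | _, _ => false
  end.

Lemma belowP x0 r r' :
  reflect (size r' <= size r /\
           forall j, j < size r' -> strict (nth x0 r j) (nth x0 r' j))
          (below r r').
Proof.
elim: r r' => [|x r IH] [|y r'] //=; try by constructor.
  by constructor => -[].
apply: (iffP andP) => [[xy /IH[sz h]]|[sz h]]; first by split=> // -[|j] //= /h.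
by split; [exact: h 0 _ | apply/IH; split=> // j; exact: h j.+1].
Qed.

Definition ssyt (la : seq nat) (S : seq X) (T : seq (seq X)) : bool :=
  [&& map size T == la, all (sorted le) T, sorted below T & perm_eq (flatten T) S].

Definition add_letter (x : X) (la : seq nat) (T : seq (seq X)) : seq (seq X) :=
  [seq p.2 ++ nseq (p.1 - size p.2) x | p <- zip la T].

(** [w] lists letters with multiplicities, largest letter first, so that each step fills the
    outermost strip and the construction runs parallel to [strip_chains]. *)
Fixpoint ssyts (w : seq (X * nat)) (la : seq nat) : seq (seq (seq X)) :=
  match w with
  | [::] => if sumn la == 0 then [:: nseq (size la) [::]] else [::]
  | (x, b) :: w' =>
      [seq add_letter x la T | nu <- strip_removals la b, T <- ssyts w' nu]
  end.

Definition weighted (w : seq (X * nat)) : seq X :=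
  flatten [seq nseq p.2 p.1 | p <- w].

Lemma size_ssyts w la : size (ssyts w la) = strip_chains (unzip2 w) la.
Proof.
elim: w la => [|[x b] w IH] la /=; first by case: (sumn la == 0).
by rewrite size_allpairs_dep sumnE big_map; apply: eq_bigr => nu _.
Qed.

(** * Removing and restoring the largest letter *)

Definition drop_letter (x : X) (r : seq X) := [seq y <- r | y != x].

Lemma drop_letter_max x r : sorted le r -> all (le^~ x) r ->
  r = drop_letter x r ++ nseq (size r - size (drop_letter x r)) x.
Proof.
elim: r => [|y r IH] //= srt /andP[yx rx].
have [eyx|nyx] /= := eqVneq y x; last first.
  by rewrite subSS {1}(IH (path_sorted srt) rx).
suff rE : r = nseq (size r) x.
  have -> : drop_letter x r = [::] by rewrite rE /drop_letter filter_nseq eqxx.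
  by rewrite subn0 /= -rE eyx.
apply/all_pred1P/allP => z zr; apply/eqP/le_anti.
rewrite (allP rx _ zr) /= -eyx.
exact: (allP (order_path_min le_trans srt) _ zr).
Qed.

(** A cell above a copy of the maximal letter [x] would need a letter strictly above [x]; hence the
    copies of [x] form a horizontal strip. *)
Lemma drop_letter_below x r r' : sorted le r -> sorted le r' ->
    all (le^~ x) r -> all (le^~ x) r' -> below r r' ->
  size r' <= size (drop_letter x r) /\ below (drop_letter x r) (drop_letter x r').
Proof.
move=> sr sr' rx r'x /(belowP x)[sz h].
have size_d : size r' <= size (drop_letter x r).
  rewrite leqNgt; apply/negP => lt.
  have := h _ lt; rewrite {1}(drop_letter_max sr rx) nth_cat ltnn subnn.
  rewrite nth_nseq if_same => /strictNle/negP; apply.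
  exact: (allP r'x) (mem_nth _ lt).
have size_d' : size (drop_letter x r') <= size r' by rewrite size_filter count_size.
split=> //; apply/(belowP x); split; first exact: leq_trans size_d.
move=> j lt; have lt' := leq_trans lt size_d'.
have := h _ lt'; rewrite {1}(drop_letter_max sr rx) {1}(drop_letter_max sr' r'x).
by rewrite !nth_cat lt (leq_trans lt' size_d).
Qed.

(** The size hypothesis puts every cell of the upper row, new ones included, over an old cell of
    [r], whose letter is strictly below [x]. *)
Lemma below_add_letter x r r' k k' : all (strict^~ x) r -> below r r' ->
  size r' + k' <= size r -> below (r ++ nseq k x) (r' ++ nseq k' x).
Proof.
move=> rx /(belowP x)[_ h] sz; apply/(belowP x); split.
  rewrite !size_cat !size_nseq; lia.
move=> j; rewrite size_cat size_nseq => lt.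
have ltr : j < size r by lia.
rewrite !nth_cat ltr; case: ifP => [/h //|_].
by rewrite nth_nseq if_same; apply: (allP rx) (mem_nth _ ltr).
Qed.

Lemma sorted_add_letter x r k : all (strict^~ x) r -> sorted le r ->
  sorted le (r ++ nseq k x).
Proof.
rewrite !sorted_pairwise // => rx sr; rewrite pairwise_cat sr /=; apply/andP; split.
  apply/allrelP => y z /(allP rx)/andP[_ yx]; rewrite mem_nseq => /andP[_ /eqP ->].
  exact: yx.
by elim: k => //= k ->; rewrite all_nseq le_refl orbT.
Qed.

Lemma size_add_letter x la T : interlace la (map size T) ->
  map size (add_letter x la T) = la.
Proof.
elim: la T => [|a la IH] [|r T] //= /andP[h /IH e].
rewrite size_cat size_nseq -/(add_letter x la T) e; congr cons; lia.
Qed.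

Lemma drop_add_letter x la T : interlace la (map size T) ->
  all (all (strict^~ x)) T -> map (drop_letter x) (add_letter x la T) = T.
Proof.
elim: la T => [|a la IH] [|r T] //= /andP[_ i] /andP[rx Tx].
rewrite -/(add_letter x la T) IH // /drop_letter filter_cat filter_nseq eqxx cats0.
by congr cons; apply/all_filterP/(sub_all _ rx) => y /andP[].
Qed.

Lemma flatten_add_letter x la T : interlace la (map size T) ->
  perm_eq (flatten (add_letter x la T))
          (nseq (sumn la - sumn (map size T)) x ++ flatten T).
Proof.
move=> i; apply/permP => a; rewrite count_cat count_nseq.
suff [-> _] : count a (flatten (add_letter x la T)) =
    a x * (sumn la - sumn (map size T)) + count a (flatten T) /\
    sumn (map size T) <= sumn la by [].
elim: la T i => [|r la IH] [|s T] //=; first by rewrite muln0.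
move=> /andP[h /IH[e le_s]]; rewrite -/(add_letter x la T); split; last lia.
rewrite !count_cat e count_nseq; case: (a x); rewrite ?mul1n ?mul0n; lia.
Qed.

Lemma ssyt_add_letter x b la nu S T : all (strict^~ x) S -> interlace la nu ->
    sumn nu + b = sumn la -> ssyt nu S T ->
  ssyt la (nseq b x ++ S) (add_letter x la T).
Proof.
move=> Sx i sb /and4P[/eqP szT srt blw p].
move: i; rewrite -szT => i.
have Tx : all (all (strict^~ x)) T.
  by rewrite -all_flatten (perm_all _ p).
apply/and4P; split.
- by rewrite size_add_letter.
- elim: la T {blw sb szT p} i srt Tx => [|a la IH] [|r T] //= /andP[_ i].
  move=> /andP[sr sT] /andP[rx Tx]; rewrite sorted_add_letter //; exact: IH.
- elim: la T {szT srt p sb} i blw Tx => [|a la IH] [|r T] //= /andP[h i].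
  move=> blw /andP[rx Tx]; have := IH _ i (path_sorted blw) Tx.
  case: la T h i blw {IH Tx} => [|a' la] [|r' T] //= h /andP[h' _] /andP[br _] ->.
  rewrite andbT; apply: below_add_letter => //; lia.
- apply: (perm_trans (flatten_add_letter x i)).
  by rewrite szT -sb addKn perm_cat2l.
Qed.

(** Together with [ssyt_add_letter] this is the bijection between tableaux with largest letter [x]
    and pairs of a strip removal and a smaller tableau. *)
Lemma ssyt_drop_letter x b la S T (T' := map (drop_letter x) T) :
    all (strict^~ x) S -> ssyt la (nseq b x ++ S) T ->
  [/\ interlace la (map size T'), sumn (map size T') + b = sumn la,
      ssyt (map size T') S T' & T = add_letter x la T'].
Proof.
move=> Sx /and4P[/eqP szT srt blw p].
have Tx : all (all (le^~ x)) T.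
  rewrite -all_flatten (perm_all _ p) all_cat all_nseq le_refl orbT /=.
  by apply: sub_all Sx => y /andP[].
have sizes T0 : sumn (map size T0) = size (@flatten X T0) by rewrite size_flatten.
have dropE T0 : flatten (map (drop_letter x) T0) = drop_letter x (flatten T0).
  by rewrite /drop_letter filter_flatten.
have pT' : perm_eq (flatten T') S.
  rewrite dropE (perm_trans (perm_filter _ p)) // filter_cat filter_nseq eqxx /=.
  by rewrite (all_filterP _) //; apply: sub_all Sx => y /andP[].
have i : interlace la (map size T').
  rewrite -szT {p pT' szT}/T'; elim: T srt blw Tx => [|r T IH] //= /andP[sr sT] blw.
  move=> /andP[rx Tx]; rewrite IH ?(path_sorted blw) // andbT.
  have -> : size (drop_letter x r) <= size r by rewrite size_filter count_size.
  rewrite andbT.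
  case: T blw {IH} sT Tx => [|r' T] //= /andP[blw _] /andP[sr' _] /andP[r'x _].
  by have [] := drop_letter_below sr sr' rx r'x blw.
split=> //.
- rewrite -szT !sizes (perm_size p) (perm_size pT') size_cat size_nseq addnC //.
- apply/and4P; split=> //.
    rewrite all_map; apply: sub_all srt => r; exact: sorted_filter.
  rewrite /T'; elim: T {i T' p szT pT'} srt blw Tx => [|r T IH] //= /andP[sr sT] blw.
  move=> /andP[rx Tx]; have := IH sT (path_sorted blw) Tx.
  case: T blw {IH} sT Tx => [|r' T] //= /andP[blw _] /andP[sr' _] /andP[r'x _] ->.
  by have [_ ->] := drop_letter_below sr sr' rx r'x blw.
- rewrite -szT /T'; elim: T {i T' p szT pT' blw} srt Tx => [|r T IH] //=.
  move=> /andP[sr sT] /andP[rx Tx]; congr cons; [exact: drop_letter_max | exact: IH].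
Qed.

Lemma ssyt_nil la T : ssyt la [::] T = (sumn la == 0) && (T == nseq (size la) [::]).
Proof.
apply/and4P/andP => [[/eqP sz _ _ p]|[/eqP s0 /eqP ->]].
  move/perm_nilP: p => f0; rewrite -sz -size_flatten f0 size_map; split=> //.
  apply/eqP/all_pred1P; elim: (T) f0 => [|r T' IH] //=.
  by case: r => //= /IH ->.
have la0 : la = nseq (size la) 0.
  by apply/all_pred1P/allP => k kla /=; rewrite -leqn0 -s0 leq_sumn_mem.
split.
- by rewrite {2}la0 map_nseq.
- by rewrite all_nseq orbT.
- by elim: (size la) => // -[|k] //= ->.
- by elim: (size la).
Qed.

Lemma sorted_rev_weighted x b w : sorted strict (rev (unzip1 ((x, b) :: w))) ->
  all (strict^~ x) (weighted w) /\ sorted strict (rev (unzip1 w)).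
Proof.
rewrite /= rev_cons !sorted_pairwise; try exact: strict_trans.
rewrite pairwise_rcons => /andP[wx pw]; split=> //.
rewrite all_flatten all_map; apply/allP => -[y k] yw /=.
rewrite all_nseq (allP wx) ?orbT // mem_rev; exact: (map_f fst yw).
Qed.

Lemma mem_ssyts w la T : sorted strict (rev (unzip1 w)) ->
  (T \in ssyts w la) = ssyt la (weighted w) T.
Proof.
elim: w la T => [|[x b] w IH] la T /=.
  rewrite ssyt_nil; case: eqP => _ //=; by rewrite inE.
move=> srt; have [Sx srtw] := sorted_rev_weighted (b := b) srt.
apply/allpairsPdep/idP => [[nu [T' [+ T'w ->]]]|h].
  rewrite mem_strip_removals => /andP[i /eqP sb].
  apply: (ssyt_add_letter _ i sb) => //; by rewrite -IH.
have [i sb h' e] := ssyt_drop_letter Sx h.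
exists (map size (map (drop_letter x) T)), (map (drop_letter x) T); split=> //.
  by rewrite mem_strip_removals i sb eqxx.
by rewrite IH.
Qed.

Lemma uniq_ssyts w la : sorted strict (rev (unzip1 w)) -> uniq (ssyts w la).
Proof.
elim: w la => [|[x b] w IH] la /=; first by case: eqP.
move=> srt; have [Sx srtw] := sorted_rev_weighted (b := b) srt.
apply: allpairs_uniq_dep => [|nu _|]; [exact: uniq_strip_removals|exact: IH|].
have back nu T : nu \in strip_removals la b -> T \in ssyts w nu ->
    map (drop_letter x) (add_letter x la T) = T /\ map size T = nu.
  rewrite mem_strip_removals mem_ssyts // => /andP[i _] /and4P[/eqP sz _ _ p].
  by rewrite drop_add_letter ?sz // -all_flatten (perm_all _ p).
move=> p q /allpairsPdep[nu [T [nus Tw ->]]] /allpairsPdep[nu' [T' [nu's T'w ->]]] /=.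
have [e1 e2] := back _ _ nus Tw; have [e1' e2'] := back _ _ nu's T'w.
by move=> e; have eT : T = T' by [rewrite -e1 e e1']; rewrite -e2 -e2' eT.
Qed.

(** Bridge from tableaux to chains: [ssyts] wants decreasing letters, so [w] is reversed, and the
    symmetry in the content undoes the reversal of the multiplicities. *)
Lemma size_ssyt_strip_chains la (w : seq (X * nat)) (S : seq X) (L : seq (seq (seq X))) :
    uniq L -> L =i ssyt la S -> perm_eq S (weighted w) ->
    sorted strict (unzip1 w) ->
  size L = strip_chains (unzip2 w) la.
Proof.
move=> uL memL pS srt.
have srt' : sorted strict (rev (unzip1 (rev w))) by rewrite /unzip1 map_rev revK.
have /perm_size -> : perm_eq L (ssyts (rev w) la).
  apply: uniq_perm => // [|T]; first exact: uniq_ssyts.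
  rewrite memL mem_ssyts // unfold_in /ssyt.
  suff /permPr -> : perm_eq (weighted (rev w)) S by [].
  rewrite perm_sym (perm_trans pS) // perm_sym; apply: perm_flatten.
  by rewrite map_rev perm_rev.
rewrite size_ssyts; apply: strip_chains_perm.
by rewrite /unzip2 map_rev perm_rev.
Qed.

End OrderedAlphabet.

(** * Kostka numbers *)

Lemma mem_words (T : eqType) (xs : seq T) k w :
  (w \in words xs k) = (size w == k) && all (mem xs) w.
Proof.
elim: k w => [|k IH] [|x w] //=.
  by apply/negbTE/negP => /allpairsP[[y v] [_ _]].
by rewrite mem_cons_allpairs IH eqSS andbCA.
Qed.

Lemma uniq_words (T : eqType) (xs : seq T) k : uniq xs -> uniq (words xs k).
Proof. by move=> uxs; elim: k => //= k IH; apply: uniq_cons_allpairs. Qed.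

Lemma uniq_flatten_map (S T : eqType) (s : seq S) (F : S -> seq T) (g : T -> S) :
    uniq s -> (forall i, i \in s -> uniq (F i)) ->
    (forall i x, i \in s -> x \in F i -> g x = i) ->
  uniq (flatten (map F s)).
Proof.
elim: s => [|i s IH] //= /andP[nis us] uF gF.
rewrite cat_uniq uF ?inE ?eqxx //= IH // => [|j js|j x js].
- rewrite andbT; apply/hasPn => x /flatten_mapP[j js xj]; apply/negP => xi.
  have gi := gF i x; have gj := gF j x.
  by move: nis; rewrite -(gi (mem_head _ _) xi) gj ?inE ?js ?orbT.
- by apply: uF; rewrite inE js orbT.
- by apply: gF; rewrite inE js orbT.
Qed.

Lemma mem_words_le (T : eqType) (xs : seq T) k w :
  (w \in words_le xs k) = (size w <= k) && all (mem xs) w.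
Proof.
apply/flatten_mapP/andP => [[i + +]|[sz wx]].
  by rewrite mem_iota mem_words => h /andP[/eqP -> ->]; split=> //; lia.
by exists (size w); rewrite ?mem_words ?eqxx // mem_iota; lia.
Qed.

Lemma uniq_words_le (T : eqType) (xs : seq T) k : uniq xs -> uniq (words_le xs k).
Proof.
move=> uxs; apply: (uniq_flatten_map (g := size)); first exact: iota_uniq.
  by move=> i _; exact: uniq_words.
by move=> i x _; rewrite mem_words => /andP[/eqP].
Qed.

Lemma mem_prodseqs_words (T : eqType) (xs : seq T) la t :
  (t \in prodseqs [seq words xs k | k <- la]) =
  (map size t == la) && all (all (mem xs)) t.
Proof.
elim: la t => [|a la IH] [|r t] //=.
  by apply/negbTE/negP => /allpairsP[[y v] [_ _]].
by rewrite mem_cons_allpairs mem_words IH eqseq_cons -!andbA; do !bool_congr.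
Qed.

Lemma uniq_prodseqs (T : eqType) (ls : seq (seq T)) :
  all uniq ls -> uniq (prodseqs ls).
Proof. by elim: ls => //= l ls IH /andP[ul /IH]; exact: uniq_cons_allpairs. Qed.

Lemma size_le_sumn s : all (fun k => 0 < k) s -> size s <= sumn s.
Proof. by elim: s => //= a s IH /andP[a0 /IH]; lia. Qed.

Lemma mem_partitions m p : (p \in partitions m) = is_partition p && (sumn p == m).
Proof.
rewrite mem_filter andb_idr // => /andP[/andP[_ pos] /eqP <-].
rewrite mem_words_le size_le_sumn //=; apply/allP => k kp /=.
by rewrite mem_iota (allP pos) // add1n ltnS leq_sumn_mem.
Qed.

Lemma uniq_partitions m : uniq (partitions m).
Proof. by apply/filter_uniq/uniq_words_le/iota_uniq. Qed.

Lemma is_partition_cons a la :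
  is_partition (a :: la) = [&& 0 < a, head 0 la <= a & is_partition la].
Proof.
rewrite /is_partition /=; case: la => [|b la] /=; first by rewrite andbT.
by rewrite -!andbA; do !bool_congr.
Qed.

Lemma head_le_sumn la : head 0 la <= sumn la.
Proof. by case: la => //= a la; lia. Qed.

Lemma msetofE la : msetof la = weighted (zip (iota 1 (size la)) la).
Proof.
rewrite /msetof /weighted; congr flatten.
suff gen k : [seq nseq (nth 0 la i) (i + k).+1 | i <- iota 0 (size la)] =
    [seq nseq p.2 p.1 | p <- zip (iota k.+1 (size la)) la].
  by rewrite -gen; apply: eq_map => i; rewrite addn0.
elim: la k => //= a la IH k; rewrite -IH -[1]addn0 iotaDl -map_comp; congr cons.
by apply: eq_map => i /=; rewrite add1n addnS.
Qed.

Lemma size_msetof la : size (msetof la) = sumn la.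
Proof.
rewrite msetofE size_flatten /shape -map_comp.
congr sumn; elim: la 1 => //= a la IH k; by rewrite size_nseq IH.
Qed.

Lemma msetof_iota la x : x \in msetof la -> x \in iota 1 (size la).
Proof.
case/flatten_mapP=> i; rewrite mem_iota => h; rewrite mem_nseq => /andP[_ /eqP ->].
by rewrite mem_iota; lia.
Qed.

(** [is_ssyt] compares columns by index over the upper row only; the hypothesis on [la] supplies
    that the upper row is not longer, as [below] demands. *)
Lemma kostka_strip_chains la mu : sorted geq la -> kostka la mu = strip_chains mu la.
Proof.
move=> srt; have -> : mu = unzip2 (zip (iota 1 (size mu)) mu).
  by rewrite unzip2_zip // size_iota.
rewrite {1}unzip2_zip ?size_iota //.
apply: (@size_ssyt_strip_chains _ leq) (perm_refl _) _.
- exact: leqnn.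
- exact: leq_trans.
- exact: anti_leq.
- apply/filter_uniq/uniq_prodseqs; rewrite all_map; apply/allP => k _ /=.
  exact/uniq_words/iota_uniq.
- move=> T; rewrite mem_filter mem_prodseqs_words [in RHS]unfold_in -msetofE.
  rewrite /is_ssyt /ssyt andb_idr; last first.
    case/and4P=> -> _ _ p /=; rewrite -all_flatten (perm_all _ p).
    exact/allP/msetof_iota.
  case: eqP => //= szT; case: (all _ T) => //=; congr (_ && _).
  apply/allP/(sortedP [::]) => [h i lti|h i].
    apply/(belowP _ 0); split.
      move: srt; rewrite -szT => /(sortedP 0) /(_ i); rewrite size_map => /(_ lti).
      by rewrite !(nth_map [::]) // ltnW.
    move=> j ltj; rewrite /strict -ltn_neqAle.
    have /h/allP : i \in iota 0 (size T).-1 by rewrite mem_iota add0n; case: (size T) lti.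
    by apply; rewrite mem_iota.
  rewrite mem_iota => lti; apply/allP => j; rewrite mem_iota => ltj.
  have /(belowP _ 0)[_ /(_ j)] : below leq (nth [::] T i) (nth [::] T i.+1).
    by apply: h; move: lti; rewrite add0n; case: (size T).
  by rewrite /strict -ltn_neqAle; apply.
- rewrite unzip1_zip ?size_iota //.
  apply: sub_sorted (iota_ltn_sorted 1 (size mu)) => x y.
  by rewrite /strict -ltn_neqAle.
Qed.

(** * Unitriangularity in the lexicographic order *)

Lemma lexle_refl : reflexive lexle.
Proof. by elim=> //= x s ->; rewrite eqxx orbT. Qed.

Lemma lexle_anti : antisymmetric lexle.
Proof.
elim=> [|x s IH] [|y t] //= /andP[/orP[h1|/andP[/eqP e1 h1]] /orP[h2|/andP[/eqP e2 h2]]]; try lia.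
by rewrite e1 (IH t) // h1.
Qed.

Lemma lexle_trans : transitive lexle.
Proof.
elim=> [|y t IH] [|x s] [|z u] //=.
case/orP=> [h1|/andP[/eqP -> h1]] /orP[h2|/andP[/eqP <- h2]].
- by rewrite (ltn_trans h1 h2).
- by rewrite h1.
- by rewrite h2.
- by rewrite eqxx (IH _ _ h1 h2) orbT.
Qed.

Lemma lexle_total : total lexle.
Proof.
by elim=> [|x s IH] [|y t] //=; case: (ltngtP x y) => //= _; apply: IH.
Qed.

Lemma strip_chains_diag la : sorted geq la -> strip_chains la la = 1.
Proof.
elim: la => [|a la IH] // srt; rewrite strip_chains_head_eq // IH //.
exact: path_sorted srt.
Qed.

(** The first strip cannot exceed the first row of [la]. If it is shorter, the order is decided; if
    it is equal, the removal is forced and the tails are compared. *)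
Lemma strip_chains_lexle la mu : sorted geq la -> all (fun k => 0 < k) mu ->
  strip_chains mu la != 0 -> lexle mu la.
Proof.
elim: mu la => [|b mu IH] [|a la] //= srt /andP[b0 mu0].
  by rewrite /strip_removals /= (_ : (0 + b == 0) = false) ?big_nil //; lia.
case: (ltngtP b a) => //= [ab|->].
  by rewrite -/(strip_chains (b :: mu) (a :: la)) strip_chains_head_lt.
rewrite -/(strip_chains (a :: mu) (a :: la)) strip_chains_head_eq //.
by apply: IH => //; exact: path_sorted srt.
Qed.

Lemma kostka_diag la : is_partition la -> kostka la la = 1.
Proof. by move=> /andP[srt _]; rewrite kostka_strip_chains // strip_chains_diag. Qed.

Lemma kostka_lexle la mu : is_partition la -> is_partition mu ->
  kostka la mu != 0 -> lexle mu la.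
Proof.
by move=> /andP[srt _] /andP[_ pos]; rewrite kostka_strip_chains //; exact: strip_chains_lexle.
Qed.

(** * Padding by a long first row, and stability *)

Lemma filter_neq0_partition la : is_partition la -> [seq k <- la | k != 0] = la.
Proof.
by move=> /andP[_ pos]; apply/all_filterP; apply: sub_all pos => k; rewrite lt0n.
Qed.

Lemma padpart_partition N la : is_partition la -> 2 * sumn la <= N ->
  padpart N la \in partitions N.
Proof.
move=> pla h; rewrite mem_partitions /padpart /= filter_neq0_partition //.
case: eqP => /= [s0|/eqP s0].
  by rewrite pla; lia.
by rewrite is_partition_cons pla; have := head_le_sumn la; lia.
Qed.

Lemma kostka_padpart N la mu k : is_partition la -> is_partition mu ->
    sumn la <= k -> sumn mu <= k -> 2 * k <= N ->
  kostka (padpart N la) (padpart N mu) =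
  strip_chains (N - sumn mu :: mu) (N - sumn la :: la).
Proof.
move=> pla pmu lak muk kN.
have nil nu : is_partition nu -> sumn nu = 0 -> nu = [::].
  by case: nu => // a nu; rewrite is_partition_cons => /and3P[a0 _ _] /= s0; exfalso; lia.
(* For [N = 0] both partitions are empty and [padpart] discards the zero first part, so this case is
   separate. *)
have [k0|k0] := posnP N.
  have -> : mu = [::] by apply: nil => //; lia.
  have -> : la = [::] by apply: nil => //; lia.
  rewrite k0 [padpart _ _]/= kostka_strip_chains //.
  by rewrite -[LHS](@strip_chains_head_eq 0).
rewrite /padpart /= !filter_neq0_partition //.
have -> /= : N - sumn la != 0 by lia.
have -> /= : N - sumn mu != 0 by lia.
apply: kostka_strip_chains.
suff: is_partition (N - sumn la :: la) by case/andP.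
by rewrite is_partition_cons pla; have := head_le_sumn la; lia.
Qed.

(** The first rows grow one cell at a time by [strip_chains_head_shift]; its condition holds because
    [la_1 <= k <= 2k - |mu|]. *)
Lemma kostka_padpart_indep N la mu k : is_partition la -> is_partition mu ->
    sumn la <= k -> sumn mu <= k -> 2 * k <= N ->
  kostka (padpart N la) (padpart N mu) =
  kostka (padpart (2 * k) la) (padpart (2 * k) mu).
Proof.
move=> pla pmu lak muk kN; rewrite !(@kostka_padpart _ _ _ k) //.
rewrite -(subnKC kN); elim: (N - _) => [|d IH]; first by rewrite addn0.
rewrite -IH !addnS.
have -> : (2 * k + d).+1 - sumn mu = (2 * k + d - sumn mu).+1 by lia.
have -> : (2 * k + d).+1 - sumn la = (2 * k + d - sumn la).+1 by lia.
by rewrite strip_chains_head_shift //; have := head_le_sumn la; lia.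
Qed.

(** * Inverting the Kostka matrix *)

Lemma big_seq_ord (V : nmodType) (T : eqType) (x0 : T) (s : seq T) (F : T -> V) :
  (\sum_(x <- s) F x = \sum_(i < size s) F (nth x0 s i))%R.
Proof. by rewrite (big_nth x0) big_mkord. Qed.

(** A one-sided inverse of a square matrix is two-sided, here for matrices indexed by the entries of
    a list. *)
Lemma seq_inverse_comm (T : eqType) (s : seq T) (F G : T -> T -> rat) :
    uniq s ->
    {in s &, forall x y, \sum_(z <- s) F x z * G z y = (x == y)%:R}%R ->
  {in s &, forall x y, \sum_(z <- s) G x z * F z y = (x == y)%:R}%R.
Proof.
case: s => // x0 s0; set s := x0 :: s0 => us FG.
pose A := (\matrix_(i < size s, j < size s) F (nth x0 s i) (nth x0 s j))%R.
pose B := (\matrix_(i < size s, j < size s) G (nth x0 s i) (nth x0 s j))%R.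
have AB : (A *m B = 1%:M)%R.
  apply/matrixP => i j; rewrite !mxE.
  under eq_bigr do rewrite !mxE.
  rewrite -(big_seq_ord x0 s (fun z => F (nth x0 s i) z * G z (nth x0 s j))%R).
  by rewrite FG ?mem_nth // nth_uniq.
have BA := mulmx1C AB => x y xs ys.
have lt z : z \in s -> index z s < size s by rewrite index_mem.
have /matrixP/(_ (Ordinal (lt x xs)) (Ordinal (lt y ys))) := BA.
rewrite !mxE; under eq_bigr do rewrite !mxE.
rewrite -(big_seq_ord x0 s (fun z => G (nth x0 s _) z * F z (nth x0 s _))%R).
rewrite /= !nth_index // => ->; rewrite -(inj_eq val_inj) /=; congr (_%:R)%R.
congr nat_of_bool; apply/eqP/eqP => [e|-> //].
have {}e : index x s = index y s := e.
by rewrite -(nth_index x0 xs) e nth_index.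
Qed.

(* Forward substitution in the Kostka system, along the lexicographic order. *)
Lemma kostka_system_eq0 m (D : pred (seq nat)) (b : seq nat -> rat) :
    (forall be ga, lexle ga be -> D be -> D ga) ->
    {in partitions m, forall be, D be ->
       \sum_(ga <- partitions m) (kostka be ga)%:R * b ga = 0}%R ->
  {in partitions m, forall be, D be -> b be = 0%R}.
Proof.
move=> Ddown sys.
pose rank be := count (fun ga => lexlt ga be) (partitions m).
suff gen r be : rank be < r -> be \in partitions m -> D be -> b be = 0%R.
  by move=> be; apply: (gen (rank be).+1).
elim: r be => // r IH be rk pbe Dbe.
have := sys be pbe Dbe; rewrite (bigD1_seq be) ?uniq_partitions //=.
have /andP[isbe _] : is_partition be && (sumn be == m) by rewrite -mem_partitions.
rewrite kostka_diag // mul1r big_seq_cond big1 ?addr0 // => ga /andP[pga nga].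
have /andP[isga _] : is_partition ga && (sumn ga == m) by rewrite -mem_partitions.
have [->|knz] := eqVneq (kostka be ga) 0; first by rewrite mul0r.
have le := kostka_lexle isbe isga knz.
have lt : lexlt ga be by rewrite /lexlt nga.
rewrite (IH ga) ?mulr0 //; last exact: Ddown Dbe.
rewrite -ltnS; apply: leq_trans rk; rewrite ltnS.
have sub : subpred (predU (lexlt^~ ga) (pred1 ga)) (lexlt^~ be).
  move=> x /orP[xga|/eqP -> //].
  by apply: strict_trans xga lt; [exact: lexle_trans | exact: lexle_anti].
apply: leq_trans (sub_count sub _); rewrite -[X in _ < X]addn0.
have <- : count (predI (lexlt^~ ga) (pred1 ga)) (partitions m) = 0.
  apply/eqP; rewrite -leqn0 leqNgt -has_count; apply/hasPn => x _ /=.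
  by apply/negP => /andP[+ /eqP e]; rewrite e /lexlt eqxx.
by rewrite count_predUI -addn1 leq_add2l -has_count has_pred1.
Qed.

(** A vector in the kernel of the transpose solves the homogeneous Kostka system, hence vanishes by
    forward substitution. *)
Lemma kostka_mx_unit m : kostka_mx m \in unitmx.
Proof.
rewrite -unitmx_tr -row_free_unit -kermx_eq0; apply/rowV0P => u /sub_kermxP uK.
have lt be : be \in partitions m -> index be (partitions m) < size (partitions m).
  by rewrite index_mem.
pose b (be : seq nat) : rat :=
  if insub (index be (partitions m)) is Some i then u ord0 i else 0%R.
have bE (i : 'I_(size (partitions m))) : b (nth [::] (partitions m) i) = u ord0 i.
  by rewrite /b index_uniq ?uniq_partitions // valK.
apply/rowP => i; rewrite mxE -bE.
apply: (@kostka_system_eq0 m predT b) => //; last exact: mem_nth.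
move=> be pbe _; rewrite (big_seq_ord [::]).
have /rowP/(_ (Ordinal (lt be pbe))) := uK; rewrite !mxE => {2}<-.
by apply: eq_bigr => j _; rewrite !mxE bE /= nth_index // mulrC.
Qed.

Lemma inv_kostkaE al be (ha : index al (partitions (sumn al)) < size (partitions (sumn al)))
    (hb : index be (partitions (sumn al)) < size (partitions (sumn al))) :
  inv_kostka al be = invmx (kostka_mx (sumn al)) (Ordinal hb) (Ordinal ha).
Proof.
rewrite /inv_kostka -!index_mem ha hb /=.
case: ltnP => [hb'|]; last by rewrite leqNgt hb.
case: ltnP => [ha'|]; last by rewrite leqNgt ha.
by congr (invmx _ _ _); apply: val_inj.
Qed.

Lemma kostka_inv_kostka m : {in partitions m &, forall al ga,
  \sum_(be <- partitions m) (kostka ga be)%:R * inv_kostka al be = (ga == al)%:R}%R.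
Proof.
move=> al ga pal pga.
have sal : sumn al = m by move: pal; rewrite mem_partitions => /andP[_ /eqP].
move: pal pga; rewrite -{m}sal => pal pga; set m := sumn al in pal pga *.
have lt be : be \in partitions m -> index be (partitions m) < size (partitions m).
  by rewrite index_mem.
have /matrixP/(_ (Ordinal (lt ga pga)) (Ordinal (lt al pal))) := mulmxV (kostka_mx_unit m).
rewrite !mxE -(inj_eq val_inj) /= (inj_in_eq (@index_inj _ [::] _)) //.
move=> <-; rewrite (big_seq_ord [::]); apply: eq_bigr => i _.
have hi : index (nth [::] (partitions m) i) (partitions m) < size (partitions m).
  by rewrite lt // mem_nth.
rewrite !mxE /= nth_index // (inv_kostkaE (lt al pal) hi); congr (_ * _)%R.
by congr (invmx _ _ _); apply: val_inj; rewrite /= index_uniq ?uniq_partitions.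
Qed.

(** For fixed [al] the numbers [inv_kostka al be] solve the Kostka system with right-hand side
    supported at [al]. The partitions not above [al] are closed downwards and avoid [al], so forward
    substitution gives zero there. *)
Lemma inv_kostka_lexle m : {in partitions m &, forall al be,
  ~~ lexle al be -> inv_kostka al be = 0%R}.
Proof.
move=> al be pal; move: be; apply: (@kostka_system_eq0 m) => [be ga gabe|be pbe Dbe].
  by apply: contra => alga; apply: lexle_trans gabe.
rewrite kostka_inv_kostka //; case: eqP => // e.
by move: Dbe; rewrite e lexle_refl.
Qed.

(** * Inversion over all partitions of bounded size *)

Definition partitions_le (k : nat) : seq (seq nat) :=
  flatten [seq partitions m | m <- iota 0 k.+1].

Lemma mem_partitions_le k la :
  (la \in partitions_le k) = is_partition la && (sumn la <= k).
Proof.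
apply/flatten_mapP/andP => [[m]|[pla lak]].
  by rewrite mem_iota mem_partitions => h /andP[-> /eqP ->]; split=> //; lia.
by exists (sumn la); rewrite ?mem_partitions ?pla ?eqxx // mem_iota; lia.
Qed.

Lemma uniq_partitions_le k : uniq (partitions_le k).
Proof.
apply: (uniq_flatten_map (g := sumn)); first exact: iota_uniq.
  by move=> m _; exact: uniq_partitions.
by move=> m la _; rewrite mem_partitions => /andP[_ /eqP].
Qed.

Lemma padpart_behead N be : be \in partitions N -> padpart N (behead be) = be.
Proof.
rewrite mem_partitions; case: be => [|b be] /andP[p /eqP <-] //.
rewrite /padpart /= addnK -[LHS]/([seq k <- b :: be | k != 0]).
exact: filter_neq0_partition.
Qed.

Lemma behead_padpart k mu : is_partition mu -> sumn mu <= k ->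
  behead (padpart (2 * k) mu) = mu.
Proof.
move=> pmu muk; rewrite /padpart /= filter_neq0_partition //.
case: eqP => //= s0; have mu0 : sumn mu = 0 by lia.
have /andP[_ pos] := pmu.
by have := size_le_sumn pos; rewrite mu0; case: (mu).
Qed.

Lemma head_padpart k mu : is_partition mu -> sumn mu <= k ->
  head 0 (padpart (2 * k) mu) = 2 * k - sumn mu.
Proof.
move=> pmu muk; have : padpart (2 * k) mu \in partitions (2 * k).
  by apply: padpart_partition => //; lia.
have := behead_padpart pmu muk; rewrite mem_partitions => + /andP[_ /eqP].
case: (padpart _ _) => [|a s] /= e; first by lia.
by rewrite e; lia.
Qed.

Lemma lexle_head s t : lexle s t -> head 0 s <= head 0 t.
Proof. by case: s t => [|x s] [|y t] //= /orP[/ltnW //|/andP[/eqP ->]]. Qed.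

(** In the full sum over partitions [be] of [N], the inverse vanishes unless [be] is at least the
    padded [la], whose first part is [|la|]. The [be] with first part at least [|la|] are exactly
    the padded [mu] with [|mu| <= |la|]. *)
Lemma kostka_inv_kostka_padpart la ka (N := 2 * sumn la) :
    is_partition la -> is_partition ka -> sumn ka <= sumn la ->
  (\sum_(mu <- partitions_le (sumn la))
     (kostka (padpart N ka) (padpart N mu))%:R
       * inv_kostka (padpart N la) (padpart N mu) = (ka == la)%:R)%R.
Proof.
move=> pla pka kala.
have padN mu : is_partition mu -> sumn mu <= sumn la -> padpart N mu \in partitions N.
  by move=> pmu h; apply: padpart_partition; rewrite // /N leq_mul2l h.
have padla := padN _ pla (leqnn _); have padka := padN _ pka kala.
have <- : (padpart N ka == padpart N la) = (ka == la).
  apply/eqP/eqP => [e|-> //].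
  by rewrite -(behead_padpart pka kala) -/N e behead_padpart.
rewrite -(kostka_inv_kostka padla padka).
rewrite [RHS](bigID (fun be => sumn la <= head 0 be)) /=.
rewrite [X in (_ + X)%R]big1_seq ?addr0; last first.
  move=> be /andP[lt pbe]; rewrite (inv_kostka_lexle padla pbe) ?mulr0 //.
  by apply: contra lt => /lexle_head; rewrite head_padpart //; lia.
rewrite -[RHS]big_filter -(big_map (padpart N) predT
  (fun be => (kostka (padpart N ka) be)%:R * inv_kostka (padpart N la) be)%R).
apply: perm_big; apply: uniq_perm.
- rewrite map_inj_in_uniq ?uniq_partitions_le // => x y.
  rewrite !mem_partitions_le => /andP[px sx] /andP[py sy] e.
  by rewrite -(behead_padpart px sx) -/N e behead_padpart.
- by apply/filter_uniq/uniq_partitions.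
move=> be; rewrite mem_filter; apply/mapP/andP => [[mu + ->]|[hd pbe]].
  rewrite mem_partitions_le => /andP[pmu muk]; split; last exact: padN.
  by rewrite head_padpart //; lia.
exists (behead be); last by rewrite padpart_behead.
move: pbe hd; rewrite mem_partitions mem_partitions_le.
case: be => [|b be] /andP[+ /eqP s] //=; rewrite is_partition_cons => /and3P[_ _ ->] /=.
by move: s; rewrite /N /=; lia.
Qed.

Lemma stildeE n la : (stilde n la = \sum_(mu <- partitions_le (sumn la))
  inv_kostka (padpart (2 * sumn la) la) (padpart (2 * sumn la) mu) *: htilde n mu)%R.
Proof.
rewrite /stilde /partitions_le big_flatten big_map /=.
by rewrite -(big_mkord predT (fun m => \sum_(mu <- partitions m)
  inv_kostka (padpart (2 * sumn la) la) (padpart (2 * sumn la) mu) *: htilde n mu)%R)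
  /index_iota subn0.
Qed.

(** [C] expresses [stilde] in [htilde], and [A] holds the Kostka numbers at padding [2 * M]. [C]
    times the transpose of [A] is the identity; so is the product in the other order, which inverts
    the relation. *)
Lemma htilde_stilde n M nu : nu \in partitions_le M ->
  (htilde n nu = \sum_(la <- partitions_le M)
     (kostka (padpart (2 * M) la) (padpart (2 * M) nu))%:R *: stilde n la)%R.
Proof.
move=> pnu; pose A ka mu : rat := ((kostka (padpart (2 * M) ka) (padpart (2 * M) mu))%:R)%R.
pose C la mu : rat := (if (sumn mu <= sumn la)%N then
   inv_kostka (padpart (2 * sumn la) la) (padpart (2 * sumn la) mu) else 0)%R.
have le_filter k : k <= M -> perm_eq [seq mu <- partitions_le M | sumn mu <= k] (partitions_le k).
  move=> kM; apply: uniq_perm; rewrite ?filter_uniq ?uniq_partitions_le //.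
  move=> mu; rewrite mem_filter !mem_partitions_le.
  by case: (is_partition mu); rewrite ?andbF //=; lia.
have CA : {in partitions_le M &, forall la ka,
    \sum_(mu <- partitions_le M) C la mu * A ka mu = (la == ka)%:R}%R.
  move=> la ka; rewrite !mem_partitions_le => /andP[pla sla] /andP[pka ska].
  rewrite (bigID (fun mu => sumn mu <= sumn la)) /= [X in (_ + X)%R]big1 ?addr0; last first.
    by move=> mu /negPf h; rewrite /C h mul0r.
  rewrite -big_filter (perm_big _ (le_filter _ sla)) /=.
  have [kala|kala] := leqP (sumn ka) (sumn la); last first.
    (* Here [|mu| <= |la| < |ka|], so the padded [mu] has the longer first part and the Kostka
       number vanishes by triangularity. *)
    have -> : (la == ka) = false by apply/eqP => e; rewrite e ltnn in kala.
    rewrite big1_seq // => mu /andP[_]; rewrite mem_partitions_le => /andP[pmu muk].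
    rewrite /A; have [->|knz] := eqVneq (kostka (padpart (2 * M) ka) (padpart (2 * M) mu)) 0.
      by rewrite mulr0.
    have hp x : is_partition x -> sumn x <= M -> padpart (2 * M) x \in partitions (2 * M).
      by move=> px sx; apply: padpart_partition => //; lia.
    have muM : sumn mu <= M by lia.
    have := hp _ pmu muM; rewrite mem_partitions => /andP[p1 _].
    have := hp _ pka ska; rewrite mem_partitions => /andP[p2 _].
    have := lexle_head (kostka_lexle p2 p1 knz); rewrite !head_padpart //; lia.
  rewrite eq_sym -(kostka_inv_kostka_padpart pla pka kala); apply: eq_big_seq => mu.
  rewrite mem_partitions_le => /andP[pmu muk]; rewrite /C muk mulrC /A.
  (* Stability passes from the padding [2 * M] to the padding [2 * |la|] used in [stilde]. *)
  by rewrite (kostka_padpart_indep pka pmu kala muk) //; lia.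
have AC := seq_inverse_comm (G := fun mu ka => A ka mu) (uniq_partitions_le M) CA.
have stE la : la \in partitions_le M ->
    (stilde n la = \sum_(mu <- partitions_le M) C la mu *: htilde n mu)%R.
  rewrite mem_partitions_le stildeE => /andP[pla sla].
  rewrite [RHS](bigID (fun mu => sumn mu <= sumn la)) /= [X in (_ + X)%R]big1 ?addr0; last first.
    by move=> mu /negPf h; rewrite /C h scale0r.
  rewrite -[RHS]big_filter (perm_big _ (le_filter _ sla)) /=; apply: eq_big_seq => mu.
  by rewrite mem_partitions_le => /andP[pmu muk]; rewrite /C muk.
transitivity (\sum_(la <- partitions_le M) \sum_(mu <- partitions_le M)
    (A la nu * C la mu) *: htilde n mu)%R.
  rewrite exchange_big /= (bigD1_seq nu) ?uniq_partitions_le //=.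
  rewrite -scaler_suml AC // eqxx scale1r big_seq_cond big1 ?addr0 // => mu /andP[pmu nmu].
  by rewrite -scaler_suml AC // eq_sym (negPf nmu) scale0r.
apply: eq_big_seq => la pla; rewrite (stE _ pla) scaler_sumr.
by apply: eq_bigr => mu _; rewrite scalerA.
Qed.

(** * Multiset partitions *)

Lemma mem_blocks l N b : (b \in blocks l N) =
  [&& b != [::], sorted leq b, size b <= N & all (mem (iota 1 l)) b].
Proof. by rewrite mem_filter mem_words_le -andbA. Qed.

Lemma uniq_blocks l N : uniq (blocks l N).
Proof. by apply/filter_uniq/uniq_words_le/iota_uniq. Qed.

Lemma size_le_flatten (T : eqType) (ss : seq (seq T)) :
  all (fun s => s != [::]) ss -> size ss <= size (flatten ss).
Proof.
move=> ne; rewrite size_flatten -(size_map size ss); apply: size_le_sumn.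
by rewrite all_map; apply: sub_all ne => -[].
Qed.

Lemma size_mem_flatten (T : eqType) (ss : seq (seq T)) s :
  s \in ss -> size s <= size (flatten ss).
Proof. by move=> h; rewrite size_flatten; apply/leq_sumn_mem/map_f. Qed.

Lemma msetof_pos la : all (fun x => 0 < x) (msetof la).
Proof. by apply/allP => x /msetof_iota; rewrite mem_iota => /andP[]. Qed.

Lemma mem_mset_partitions S pi : all (fun x => 0 < x) S ->
  (pi \in mset_partitions S) = is_mset_partition S pi.
Proof.
move=> posS; rewrite mem_filter andb_idr // => /andP[/andP[ok _] p].
have szS := perm_size p.
have nepi : all (fun b => b != [::]) pi by apply: sub_all ok => b /andP[].
rewrite mem_words_le -szS size_le_flatten //=; apply/allP => b bpi.
rewrite /= mem_blocks; have /andP[-> ->] := allP ok _ bpi.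
rewrite size_mem_flatten //=; apply/allP => x xb /=.
have xS : x \in S by rewrite -(perm_mem p); apply/flattenP; exists b.
rewrite mem_iota (allP posS) // add1n ltnS.
by elim: (S) xS => //= y s IH; rewrite inE => /orP[/eqP ->|/IH]; lia.
Qed.

Lemma uniq_mset_partitions S : uniq (mset_partitions S).
Proof. exact/filter_uniq/uniq_words_le/uniq_blocks. Qed.

Lemma size_mset_partition mu pi :
  pi \in mset_partitions (msetof mu) -> size pi <= sumn mu.
Proof.
rewrite mem_mset_partitions ?msetof_pos // => /andP[/andP[ok _] pe].
rewrite -size_msetof -(perm_size pe); apply: size_le_flatten.
by apply: sub_all ok => b /andP[].
Qed.

(** * Multiplicities and the recursion for [htilde] *)

Lemma geq_trans : transitive geq.
Proof. by move=> y x z yx zy; apply: leq_trans zy yx. Qed.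

Lemma geq_anti : antisymmetric geq.
Proof. by move=> x y; rewrite andbC => /anti_leq. Qed.

Lemma geq_total : total geq.
Proof. by move=> x y; exact: leq_total. Qed.

Lemma sumn_mult_partition pi : sumn (mult_partition pi) = size pi.
Proof.
have /perm_sumn -> : perm_eq (mult_partition pi) [seq count_mem b pi | b <- undup pi].
  by rewrite perm_sort.
rewrite -[RHS](perm_size (perm_count_undup pi)) size_flatten /shape -map_comp.
by congr sumn; apply: eq_map => b /=; rewrite size_nseq.
Qed.

Lemma mult_partition_partition pi : is_partition (mult_partition pi).
Proof.
rewrite /is_partition sort_sorted; last exact: geq_total.
rewrite all_sort all_map; apply/allP => b; rewrite mem_undup /= => bpi.
by rewrite -has_count has_pred1.
Qed.

(** Each recursive call goes to a partition of size [size pi < sumn la], so fuel beyond [sumn la]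
    does not change the value. *)
Lemma htilde_f_fuel n k k' la : sumn la <= k -> sumn la <= k' ->
  htilde_f n k la = htilde_f n k' la.
Proof.
elim: k k' la => [|k IH] [|k'] la //= lek lek'.
- by rewrite big1 ?subr0 // => pi; lia.
- by rewrite big1 ?subr0 // => pi; lia.
congr (_ - _)%R; apply: eq_bigr => pi lt; apply: IH; rewrite sumn_mult_partition; lia.
Qed.

Lemma htilde_rec n la : (htilde n la = hpart n la -
  \sum_(pi <- mset_partitions (msetof la) | (size pi < sumn la)%N)
     htilde n (mult_partition pi))%R.
Proof.
rewrite /htilde (@htilde_f_fuel _ _ (sumn la).+1) //=; congr (_ - _)%R.
by apply: eq_bigr => pi lt; apply: htilde_f_fuel; rewrite sumn_mult_partition // ltnW.
Qed.

Lemma weighted_letters (X : eqType) (w : seq (X * nat)) x :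
  x \in weighted w -> x \in unzip1 w.
Proof.
case/flatten_mapP=> p pw; rewrite mem_nseq => /andP[_ /eqP ->]; exact: map_f.
Qed.

Lemma count_weighted (X : eqType) (w : seq (X * nat)) : uniq (unzip1 w) ->
  [seq count_mem x (weighted w) | x <- unzip1 w] = unzip2 w.
Proof.
elim: w => [|[x k] w IH] //= /andP[nx uw].
rewrite count_cat count_nseq /= eqxx mul1n (count_memPn _) ?addn0; last first.
  by apply: contra nx; exact: weighted_letters.
congr cons; rewrite -[RHS]IH //; apply/eq_in_map => y yw.
rewrite count_cat count_nseq /=; case: eqP => // e.
by rewrite e yw in nx.
Qed.

Lemma msetof_sorted la : sorted leq (msetof la).
Proof.
rewrite msetofE; elim: la 1 => // a la IH k.
rewrite sorted_pairwise; last exact: leq_trans.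
rewrite /= /weighted /= pairwise_cat; apply/and3P; split.
- apply/allrelP => x y; rewrite mem_nseq => /andP[_ /eqP ->] /weighted_letters.
  rewrite unzip1_zip ?size_iota // mem_iota; lia.
- by elim: a => //= a ->; rewrite all_nseq leqnn orbT.
- by rewrite -sorted_pairwise ?IH //; exact: leq_trans.
Qed.

Lemma lexle_singletons s : sorted lexle [seq [:: x] | x <- s] = sorted leq s.
Proof.
rewrite sorted_map; apply: eq_sorted => x y /=.
by rewrite andbT orbC -leq_eqVlt.
Qed.

(** Blocks are nonempty, so there are at most as many as letters, with equality only if every block
    has one letter. *)
Lemma mset_partition_singletons mu pi : is_mset_partition (msetof mu) pi ->
  sumn mu <= size pi -> pi = [seq [:: x] | x <- msetof mu].
Proof.
case/andP=> /andP[ok srt] p le.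
have piE : pi = [seq [:: x] | x <- flatten pi].
  have := perm_size p; rewrite size_msetof => sz; rewrite -sz in le.
  elim: pi ok le {srt p sz} => [|b pi IH] //= /andP[/andP[ne _] ok].
  rewrite size_cat => le.
  have nepi : all (fun b => b != [::]) pi by apply: sub_all ok => c /andP[].
  have := size_le_flatten nepi; case: b ne le => [|x [|y b]] //= _ le le'; last by lia.
  by rewrite -IH.
rewrite piE; congr map; apply: (sorted_eq leq_trans anti_leq) => //.
  by rewrite -lexle_singletons -piE.
exact: msetof_sorted.
Qed.

Lemma singletons_mset_partition mu :
  is_mset_partition (msetof mu) [seq [:: x] | x <- msetof mu].
Proof.
rewrite /is_mset_partition lexle_singletons msetof_sorted andbT.
rewrite all_map all_predT flatten_seq1.
by rewrite perm_refl.
Qed.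

Lemma mult_partition_singletons mu : is_partition mu ->
  mult_partition [seq [:: x] | x <- msetof mu] = mu.
Proof.
move=> /andP[srt pos]; apply: (sorted_eq geq_trans geq_anti) => //.
  exact/sort_sorted/geq_total.
rewrite perm_sort undup_map_inj; last by move=> x y [].
rewrite -map_comp.
rewrite (eq_map (g := fun x => count_mem x (msetof mu))) => [|x /=]; last first.
  rewrite count_map; apply: eq_count => y /=.
  by rewrite eqseq_cons eqxx andbT.
have pu : perm_eq (undup (msetof mu)) (iota 1 (size mu)).
  apply: uniq_perm; rewrite ?undup_uniq ?iota_uniq // => x; rewrite mem_undup.
  apply/idP/idP => [/msetof_iota //|]; rewrite mem_iota => hx.
  apply/flatten_mapP; exists x.-1; first by rewrite mem_iota; lia.
  rewrite mem_nseq; apply/andP; split; last by apply/eqP; lia.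
  by apply: (allP pos); apply: mem_nth; case: x hx.
rewrite (perm_trans (perm_map _ pu)) //.
have wE : unzip1 (zip (iota 1 (size mu)) mu) = iota 1 (size mu).
  by rewrite unzip1_zip // size_iota.
by rewrite msetofE -[X in map _ X]wE count_weighted ?wE ?iota_uniq // unzip2_zip ?size_iota.
Qed.

(** The recursion subtracts all multiset partitions with fewer than [sumn mu] blocks; the only
    remaining one consists of singletons and contributes [htilde n mu]. *)
Lemma hpart_htilde n mu : is_partition mu ->
  (hpart n mu = \sum_(pi <- mset_partitions (msetof mu)) htilde n (mult_partition pi))%R.
Proof.
move=> pmu; rewrite (bigID (fun pi => size pi < sumn mu)%N) /=.
rewrite -[hpart n mu](subrK (\sum_(pi <- mset_partitions (msetof mu) | (size pi < sumn mu)%N)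
  htilde n (mult_partition pi))%R) -htilde_rec addrC; congr (_ + _)%R.
have pe : perm_eq [seq pi <- mset_partitions (msetof mu) | ~~ (size pi < sumn mu)]
    [:: [seq [:: x] | x <- msetof mu]].
  apply: uniq_perm => [||pi] //; first exact/filter_uniq/uniq_mset_partitions.
  rewrite mem_filter inE mem_mset_partitions ?msetof_pos // -leqNgt.
  apply/andP/eqP => [[le h]|->]; first exact: mset_partition_singletons.
  by rewrite size_map size_msetof leqnn singletons_mset_partition.
by rewrite -big_filter (perm_big _ pe) big_seq1 mult_partition_singletons.
Qed.

(** * Tableaux with a blank first row *)

Definition is_block (b : seq nat) : bool :=
  (b != [::]) && sorted leq b && all (fun x => 0 < x) b.

Lemma nth_tab_shape_sorted T i : is_partition (tab_shape T) -> 0 < i ->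
  size (nth [::] T i.+1) <= size (nth [::] T i).
Proof.
case: T => [|r0 T]; first by rewrite !nth_nil.
case: i => // i /andP[/path_sorted srt _] _ /=.
have [lt|ge] := ltnP i.+1 (size T); last by rewrite (nth_default _ ge).
have := (sortedP 0 srt) i; rewrite size_map => /(_ lt).
by rewrite !(nth_map [::]) // ltnW.
Qed.

Lemma size_nth_tab_shape T i : is_partition (tab_shape T) -> 0 < i ->
  size (nth [::] T i) <= nth 0 (tab_shape T) 0.
Proof.
move=> p; case: i => // i _; elim: i => [|i IH].
  by case: T p => [|r0 [|r1 T]] //= _; exact: leq_addl.
by apply: leq_trans IH; exact: nth_tab_shape_sorted.
Qed.

(* Row 1 starts below the first filled cell of row 0, so only the rows above
   row 0 are constrained by column strictness. *)
Lemma skew_columns T : is_partition (tab_shape T) ->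
  all (fun i => all (fun j =>
       match tab_cell T i j, tab_cell T i.+1 j with
       | Some a, Some b => lexlt a b
       | _, _ => true
       end) (iota 0 (nth 0 (tab_shape T) 0)))
    (iota 0 (size T)) = sorted (below lexle) (behead T).
Proof.
move=> p.
have cellS i j : tab_cell T i.+1 j =
    if j < size (nth [::] T i.+1) then Some (nth [::] (nth [::] T i.+1) j) else None.
  by rewrite /tab_cell /= nth_nil subn0.
have nthb i : nth [::] (behead T) i = nth [::] T i.+1 by rewrite nth_behead.
apply/allP/(sortedP [::]) => [h i lti|h i].
  rewrite !nthb; apply/(belowP _ [::]).
  have le := nth_tab_shape_sorted p (ltn0Sn i).
  split=> // j ltj; have ltj' := leq_trans ltj le.
  have /h/allP/(_ j) : i.+1 \in iota 0 (size T).
    rewrite mem_iota add0n leq0n; move: lti; rewrite size_behead.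
    by case: (size T) => // s /ltnW.
  rewrite !cellS ltj ltj'; apply; rewrite mem_iota add0n leq0n.
  exact: leq_trans ltj' (size_nth_tab_shape p (ltn0Sn i)).
rewrite mem_iota => /= lti; apply/allP => j _.
rewrite cellS; case: i lti => [|i] lti.
  rewrite {1}/tab_cell /=; case: ifP => // /andP[le _].
  by rewrite ltnNge le.
rewrite cellS; case: ifP => // lt1; case: ifP => // lt2.
have lti2 : i.+2 < size T.
  by rewrite ltnNge; apply: contraL lt2 => ge; rewrite (nth_default _ ge).
have /h : i.+1 < size (behead T) by rewrite size_behead ltn_predRL.
by rewrite !nthb => /(belowP _ [::])[_]; apply.
Qed.

Lemma is_skew_tableauE mu T : is_skew_tableau mu T =
  [&& is_partition (tab_shape T), all (all is_block) T, all (sorted lexle) T,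
      sorted (below lexle) (behead T) & perm_eq (flatten (flatten T)) (msetof mu)].
Proof.
rewrite /is_skew_tableau; case p: (is_partition _) => //=.
rewrite skew_columns //.
suff -> : tab_inner T == [:: nth 0 (tab_shape T) 1] by [].
by case: (T) => [|r0 [|r1 T']].
Qed.

Lemma bar_tab_shape T : bar (tab_shape T) = map size (behead T).
Proof. by case: T. Qed.

Lemma mem_skew_tableaux mu T : (T \in skew_tableaux mu) = is_skew_tableau mu T.
Proof.
rewrite mem_filter andb_idr // is_skew_tableauE => /and5P[p ok _ _ pe].
have okf : all is_block (flatten T) by rewrite all_flatten.
have szfT : size (flatten T) <= sumn mu.
  rewrite -size_msetof -(perm_size pe); apply: size_le_flatten.
  by apply: sub_all okf => b /andP[/andP[]].
rewrite mem_words_le; apply/andP; split.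
  (* The bottom row may have no filled cell while every other row has one, which accounts for the
     [N.+1] rows allowed. *)
  case: T p szfT {ok pe okf} => [|r0 rs] //= /andP[_ /= /andP[_ pos]].
  rewrite size_cat ltnS => le; have := size_le_sumn pos.
  rewrite size_map -size_flatten; lia.
apply/allP => r rT /=; rewrite mem_words_le.
rewrite (leq_trans (size_mem_flatten rT) szfT) /=; apply/allP => b br /=.
have bT : b \in flatten T by apply/flattenP; exists r.
have /andP[/andP[ne srt] _] := allP okf _ bT.
rewrite mem_blocks ne srt -size_msetof -(perm_size pe) size_mem_flatten //=.
apply/allP => x xb; apply: msetof_iota; rewrite -(perm_mem pe).
by apply/flattenP; exists b.
Qed.

Lemma uniq_skew_tableaux mu : uniq (skew_tableaux mu).
Proof. exact/filter_uniq/uniq_words_le/uniq_words_le/uniq_blocks. Qed.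

(* Filling the blank cells of the first row (and more cells in front of them)
   with the empty multiset, the least letter, turns a skew tableau into a
   semistandard one. *)
Definition fill_blank (p : nat) (T : seq (seq (seq nat))) : seq (seq (seq nat)) :=
  (nseq p [::] ++ head [::] T) :: behead T.

Lemma sorted_nseq_nil p r : sorted lexle r -> sorted lexle (nseq p [::] ++ r).
Proof.
have lt := lexle_trans; rewrite !sorted_pairwise // => sr.
rewrite pairwise_cat sr andbT; apply/andP; split.
  by apply/allrelP => y z; rewrite mem_nseq => /andP[_ /eqP ->].
by elim: p => //= p ->; rewrite all_nseq orbT.
Qed.

Lemma sorted_lexle_nseq_nil r : sorted lexle r ->
  r = nseq (count_mem [::] r) [::] ++ [seq b <- r | b != [::]].
Proof.
elim: r => //= b r IH srt; have := IH (path_sorted srt).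
have [-> /= <- //|nb] := eqVneq b [::].
suff -> : count_mem [::] r = 0 by move=> /= <-.
apply/count_memPn/negP => nr.
have := allP (order_path_min lexle_trans srt) _ nr.
by case: (b) nb.
Qed.

Lemma path_below_nonempty r rs : path (below lexle) r rs ->
  all (all (fun b => b != [::])) rs.
Proof.
elim: rs r => //= r' rs IH r /andP[blw /IH ->]; rewrite andbT.
elim: r r' blw => [|x r IHr] [|y r'] //= /andP[/andP[nxy xy] /IHr ->].
by rewrite andbT; apply: contraNneq nxy => e; move: xy; rewrite e; case: x.
Qed.

Lemma strict_nil b : b != [::] -> strict lexle [::] b.
Proof. by case: b. Qed.

(** Of the [size pi] entries, [sumn la] lie above the bottom row, so adding [N - size pi] empty
    multisets makes the bottom row [N - sumn la] long. *)
Lemma fill_blank_ssyt mu T (pi := sort lexle (flatten T)) (la := bar (tab_shape T))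
    (N := 2 * sumn mu) :
  T \in skew_tableaux mu ->
  [/\ pi \in mset_partitions (msetof mu), la \in partitions_le (sumn mu),
      size pi <= sumn mu &
      ssyt lexle (N - sumn la :: la) (nseq (N - size pi) [::] ++ pi)
        (fill_blank (N - size pi) T)].
Proof.
rewrite mem_skew_tableaux is_skew_tableauE => /and5P[p ok srt blw pe].
have okf : all is_block (flatten T) by rewrite all_flatten.
have pT : perm_eq pi (flatten T) by rewrite perm_sort.
have szpi : size pi <= sumn mu.
  rewrite -size_msetof -(perm_size pe) (perm_size pT); apply: size_le_flatten.
  by apply: sub_all okf => b /andP[/andP[]].
have szT : size pi = size (head [::] T) + sumn la.
  rewrite (perm_size pT) /la bar_tab_shape -size_flatten.
  by case: (T) => //= r0 rs; rewrite size_cat.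
have pla : is_partition la.
  move: p; rewrite /la /bar; case: (tab_shape T) => // a l.
  by rewrite is_partition_cons => /and3P[].
split=> //.
- rewrite mem_mset_partitions ?msetof_pos //; apply/andP; split.
    rewrite sort_sorted ?andbT; last exact: lexle_total.
    by rewrite (perm_all _ pT); apply: sub_all okf => b /andP[].
  exact: perm_trans (perm_flatten pT) pe.
- rewrite mem_partitions_le pla; lia.
apply/and4P; split.
- rewrite /= size_cat size_nseq -bar_tab_shape -/la; apply/eqP; congr cons; lia.
- rewrite /= sorted_nseq_nil; last by case: (T) srt => //= r rs /andP[].
  by case: (T) srt => //= r rs /andP[].
- move: blw szT; rewrite /la bar_tab_shape /fill_blank /=.
  case E: (behead T) => [|r1 rs] //= -> szT; rewrite andbT.
  have ok1 : all is_block r1.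
    by apply: (allP ok); apply: mem_behead; rewrite E mem_head.
  (* As [|r1| <= |la| <= |pi| <= |mu|] and [N = 2|mu|], the whole second row stands over empty
     multisets. *)
  have le1 : size r1 <= N - size pi by rewrite /N; lia.
  apply/(belowP _ [::]); rewrite size_cat size_nseq.
  split=> [|j ltj]; first exact: leq_trans le1 (leq_addr _ _).
  rewrite nth_cat size_nseq (leq_trans ltj le1) nth_nseq if_same strict_nil //.
  by have /andP[/andP[]] := allP ok1 _ (mem_nth [::] ltj).
- rewrite /fill_blank /= -catA perm_cat2l perm_sym (perm_trans pT) //.
  by case: (T).
Qed.

(** Column strictness confines the least letter, the empty multiset, to the bottom row, where it
    comes first; deleting its copies gives [T]. *)
Lemma fill_blank_surj mu pi la U (N := 2 * sumn mu) :
    pi \in mset_partitions (msetof mu) -> is_partition la ->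
    ssyt lexle (N - sumn la :: la) (nseq (N - size pi) [::] ++ pi) U ->
  exists2 T, [/\ T \in skew_tableaux mu, sort lexle (flatten T) = pi &
                 bar (tab_shape T) = la] &
             U = fill_blank (N - size pi) T.
Proof.
rewrite mem_mset_partitions ?msetof_pos // => /andP[/andP[okpi srtpi] ppi] pla.
case: U => [|u0 rs] /and4P[//]; rewrite [map _ _]/= eqseq_cons => /andP[_ /eqP szrs].
move=> /= /andP[su0 srs] blw pU.
have ners := path_below_nonempty blw.
pose r0 := [seq b <- u0 | b != [::]].
have u0E : u0 = nseq (N - size pi) [::] ++ r0.
  rewrite {1}(sorted_lexle_nseq_nil su0); congr (nseq _ _ ++ _).
  have := permP pU (pred1 [::]); rewrite !count_cat count_nseq /= mul1n.
  have -> : count_mem [::] (flatten rs) = 0.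
    apply/count_memPn/negP => /(allP (etrans (all_flatten _ _) ners)).
    by rewrite eqxx.
  have -> : count_mem [::] pi = 0; last by rewrite !addn0.
  by apply/count_memPn/negP => /(allP okpi); rewrite eqxx.
have pT : perm_eq (r0 ++ flatten rs) pi.
  by move: pU; rewrite u0E -catA perm_cat2l.
(* Without filled cells [T] must be the empty list: a single empty row would have shape [[:: 0]],
   which is not a partition. *)
pose T := if (r0 == [::]) && (rs == [::]) then [::] else r0 :: rs.
have hT : head [::] T = r0 by rewrite /T; case: eqP => //= ->; case: eqP.
have bT : behead T = rs by rewrite /T; case: eqP => //= _; case: eqP => //= ->.
have fT : flatten T = r0 ++ flatten rs.
  by rewrite /T; case: eqP => //= ->; case: eqP => //= ->.
have sT : all (sorted lexle) T.
  suff : all (sorted lexle) (r0 :: rs) by rewrite /T; case: ifP.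
  by rewrite /= srs andbT sorted_filter //; exact: lexle_trans.
have barT : bar (tab_shape T) = la by rewrite bar_tab_shape bT.
exists T; last by rewrite /fill_blank hT bT -u0E.
have okf : all is_block (flatten T).
  apply/allP => b; rewrite fT (perm_mem pT) => bpi; rewrite /is_block (allP okpi) //=.
  apply/allP => x xb; apply: (allP (msetof_pos mu)).
  by rewrite -(perm_mem ppi); apply/flattenP; exists b.
split=> //; last first.
  apply: (sorted_eq lexle_trans lexle_anti) => //; first exact/sort_sorted/lexle_total.
  by rewrite perm_sort fT.
rewrite mem_skew_tableaux is_skew_tableauE; apply/and5P; split=> //.
- rewrite /T; case: ifP => // ne; rewrite /= szrs is_partition_cons pla.
  move: ne pla; rewrite -szrs; case: (rs) => [|r1 rs'] /=; last first.
    by rewrite is_partition_cons => _ /and3P[? _ _]; lia.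
  by rewrite eqxx andbT addn0 -size_eq0 => ne _; rewrite lt0n ne.
- by rewrite -all_flatten.
- by rewrite bT; exact: path_sorted blw.
- by rewrite (perm_trans _ ppi) // perm_flatten // fT.
Qed.

(** The only lists that [fill_blank] confuses are [[::]] and [[:: [::]]], and the shape of the
    latter is not a partition. *)
Lemma fill_blank_inj mu p : {in skew_tableaux mu &, injective (fill_blank p)}.
Proof.
move=> T T'; rewrite !mem_skew_tableaux !is_skew_tableauE.
move=> /andP[pT _] /andP[pT' _] [/eqP]; rewrite eqseq_cat // eqxx => /eqP.
case: T T' pT pT' => [|r rs] [|r' rs'] pT pT' //= e1 e2.
- by move: pT'; rewrite -e1 -e2.
- by move: pT; rewrite e1 e2.
- by rewrite e1 e2.
Qed.

(** [fill_blank] matches these tableaux with the semistandard ones of shape [(N - |la|, la)] whose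
    letters are the empty multiset and the distinct blocks of [pi]. *)
Lemma count_skew_tableaux mu pi la (N := 2 * sumn mu) :
    pi \in mset_partitions (msetof mu) -> la \in partitions_le (sumn mu) ->
  count (fun T => (sort lexle (flatten T) == pi) && (bar (tab_shape T) == la))
        (skew_tableaux mu)
  = kostka (padpart N la) (padpart N (mult_partition pi)).
Proof.
move=> ppi; rewrite mem_partitions_le => /andP[pla sla].
set a := fun T => _.
have szpi := size_mset_partition ppi.
rewrite (@kostka_padpart _ _ _ (sumn mu)) ?mult_partition_partition ?sumn_mult_partition //.
pose w := ([::] : seq nat, N - size pi) :: [seq (b, count_mem b pi) | b <- undup pi].
(* [w] takes the multiplicities in the order of the blocks while [mult_partition] sorts them; the
   symmetry in the content reconciles the two. *)
rewrite (@strip_chains_perm _ (unzip2 w)); last first.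
  by rewrite /= perm_cons perm_sort /unzip2 -map_comp perm_refl.
rewrite -size_filter -(size_map (fill_blank (N - size pi))).
apply: (@size_ssyt_strip_chains _ lexle lexle_refl lexle_trans lexle_anti _ w
  (nseq (N - size pi) [::] ++ pi)).
- rewrite map_inj_in_uniq; first exact/filter_uniq/uniq_skew_tableaux.
  move=> T T'; rewrite 2!(mem_filter a) => /andP[_ h] /andP[_ h'].
  exact: (fill_blank_inj h h').
- move=> U; rewrite [in RHS]unfold_in; apply/mapP/idP => [[T + ->]|h].
    rewrite mem_filter => /andP[/andP[/eqP <- /eqP <-] hT].
    by have [] := fill_blank_ssyt hT.
  have [T [hT e1 e2] ->] := fill_blank_surj ppi pla h.
  by exists T; rewrite // mem_filter /a e1 e2 !eqxx.
- rewrite /weighted /= perm_cat2l perm_sym -map_comp.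
  exact: perm_count_undup.
- move: ppi; rewrite mem_mset_partitions ?msetof_pos // => /andP[/andP[ok srt] _].
  rewrite /= /unzip1 -map_comp map_id.
  have su : sorted (strict lexle) (undup pi).
    have := undup_sorted lexle_trans srt.
    rewrite sorted_pairwise ?sorted_pairwise; try exact: lexle_trans;
      try exact: (strict_trans lexle_trans lexle_anti).
    move=> pw; have := undup_uniq pi; rewrite uniq_pairwise => pu.
    by rewrite (pairwise_relI) pu pw.
  rewrite path_sortedE; last exact: (strict_trans lexle_trans lexle_anti).
  rewrite su andbT; apply/allP => b; rewrite mem_undup => bpi.
  by apply: strict_nil; have /andP[] := allP ok _ bpi.
Qed.

(** * Grouping the tableaux by entries and by shape *)

Lemma big_seq_fiber (V : nmodType) (S T : eqType) (s : seq S) (t : seq T)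
    (g : S -> T) (F : S -> V) :
    uniq t -> {in s, forall x, g x \in t} ->
  (\sum_(x <- s) F x = \sum_(y <- t) \sum_(x <- s | g x == y) F x)%R.
Proof.
move=> ut gt; rewrite (exchange_big_dep predT) //=.
apply: eq_big_seq => x xs; rewrite -big_filter.
have -> : [seq y <- t | g x == y] = [:: g x]; last by rewrite big_seq1.
rewrite (eq_filter (a2 := pred1 (g x))); last by move=> y; rewrite /= eq_sym.
by rewrite filter_pred1_uniq // gt.
Qed.

Theorem theorem5 (n : nat) (mu : seq nat) :
  is_partition mu ->
  hpart n mu = (\sum_(T <- skew_tableaux mu) stilde n (bar (tab_shape T)))%R.
Proof.
move=> pmu; rewrite hpart_htilde //.
(* Tableaux are grouped first by the multiset partition of their entries, then by shape. *)
rewrite [RHS](big_seq_fiber _ (uniq_mset_partitions (msetof mu))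
  (g := fun T => sort lexle (flatten T))); last first.
  by move=> T hT; have [] := fill_blank_ssyt hT.
apply: eq_big_seq => pi ppi.
have szpi : mult_partition pi \in partitions_le (sumn mu).
  rewrite mem_partitions_le mult_partition_partition sumn_mult_partition.
  exact: size_mset_partition.
rewrite (htilde_stilde n szpi) -[RHS]big_filter.
rewrite [RHS](big_seq_fiber _ (uniq_partitions_le (sumn mu))
  (g := fun T => bar (tab_shape T))); last first.
  by move=> T; rewrite mem_filter => /andP[_ hT]; have [] := fill_blank_ssyt hT.
apply: eq_big_seq => la pla.
(* All tableaux of one group contribute the same [stilde n la], and their number is the coefficient
   in [htilde_stilde]. *)
rewrite -count_skew_tableaux // big_filter_cond.
rewrite (eq_bigr (fun=> stilde n la)) => [|T /andP[_ /eqP -> //]].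
by rewrite big_const_seq iter_addr_0 scaler_nat.
Qed.
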